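(* Let $G=(V,E)$ be a control-flow graph with entry $s$ and terminal $t$ as in the context. The algorithm LOCAL-INSTRUMENTATION described in the context returns a valid vertex-coverage edge-instrumentation scheme for $G$ whose size is at most twice the minimum size of a valid vertex-coverage edge-instrumentation scheme for $G$.
   Context: $G=(V,E)$ is a finite directed graph with distinct nodes $s,t$ such that $s$ has in-degree $0$, $t$ has out-degree $0$, every node is reachable from $s$ and every node can reach $t$ by directed paths. $N^{in}(u),N^{out}(u)$ denote in- and out-neighbour sets. An execution trace is a finite collection of (not necessarily simple) directed $s$-$t$ walks; its vertex coverage profile $C:V\to\{\top,\bot\}$ has $C(u)=\top$ iff $u$ lies on some walk, and its edge coverage profile $C^E:E\to\{\top,\bot\}$ has $C^E(e)=\top$ iff $e$ is traversed by some walk. A vertex-coverage edge-instrumentation scheme is a pair $(F,\Psi)$ with $F\subseteq E$ and $\Psi$ an efficiently computable map from restrictions to $F$ of edge coverage profiles to vertex coverage profiles; it is valid if $\Psi(C^E|_F)=C$ for every execution trace; its size is $|F|$. $A(u)$ is the set of nodes reachable from $s$ by a directed path avoiding $u$; $B(u)$ the set of nodes that can reach $t$ by a directed path avoiding $u$. A vertex $u$ is ambiguous if it has an in-neighbour and an out-neighbour in $A(u)\cap B(u)$. A node $u$ is forward inferable if $N^{out}(u)\setminus A(u)\neq\emptyset$ and $N^{out}(u)\cap A(u)\cap B(u)=\emptyset$, with forward inference edges $(u,v)$, $v\in N^{out}(u)\setminus A(u)$; it is backward inferable if $N^{in}(u)\setminus B(u)\neq\emptyset$ and $N^{in}(u)\cap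 A(u)\cap B(u)=\emptyset$, with backward inference edges $(u,v)$, $v\in N^{in}(u)\setminus B(u)$. The union of the forward and backward inference graphs has connected components each consisting of a forward inference path $v_1,\dots,v_k$ (edges $(v_i,v_{i+1})$, which are edges of $G$) together with the reversed backward inference path. Algorithm LOCAL-INSTRUMENTATION: for each ambiguous vertex $u$, with $X=N^{in}(u)\cap A(u)\cap B(u)$ and $Y=N^{out}(u)\cap A(u)\cap B(u)$, instrument (add to $F$) all edges from $X$ to $u$ or all edges from $u$ to $Y$, whichever of $X,Y$ has smaller cardinality. For each connected component $v_1,\dots,v_k$ with $k\ge2$ of the union of the inference graphs such that $v_1$ is not backward inferable and $v_k$ is not forward inferable, instrument a single edge of $G$ along the path $v_1,\dots,v_k$. The coverage of all vertices is then inferred from the instrumented edges, using, as in the inference-scheme framework, that a forward (resp. backward) inferable vertex is covered iff one of its forward (resp. backward) inference successors is covered. *)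

(* Defs.v *)
From HB Require Import structures.
From mathcomp Require Import all_boot.

Set Implicit Arguments.
Unset Strict Implicit.
Unset Printing Implicit Defensive.

Record cfg := Cfg {
  node :> finType;
  arc : rel node;
  entry : node;
  exit : node;
  entry_neq_exit : entry != exit;
  entry_indeg0 : forall u, ~~ arc u entry;
  exit_outdeg0 : forall u, ~~ arc exit u;
  entry_reaches : forall u, connect arc entry u;
  reaches_exit : forall u, connect arc u exit
}.

Definition edge (G : cfg) : finType := {e : G * G | arc e.1 e.2}.

(** ** Execution traces and coverage profiles *)

(* A walk from the entry to the exit is given by the nodes that follow the
   entry; the arcs it traverses are the pairs in [zip (entry G :: w) w]. *)
Definition is_walk (G : cfg) (w : seq G) : bool :=
  path (@arc G) (entry G) w && (last (entry G) w == exit G).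

(* The empty trace is allowed. *)
Definition execution_trace (G : cfg) (tr : seq (seq G)) : bool :=
  all (@is_walk G) tr.

Definition vertex_coverage (G : cfg) (tr : seq (seq G)) : {ffun G -> bool} :=
  [ffun u => has (fun w => u \in entry G :: w) tr].

Definition edge_coverage (G : cfg) (tr : seq (seq G)) :
    {ffun edge G -> bool} :=
  [ffun e => has (fun w => val e \in zip (entry G :: w) w) tr].

(** ** Instrumentation schemes *)

Definition restricted_profile (G : cfg) (F : {set edge G}) : Type :=
  {ffun {e : edge G | e \in F} -> bool}.

Definition restrict (G : cfg) (F : {set edge G}) (c : {ffun edge G -> bool}) :
    restricted_profile F :=
  [ffun e => c (val e)].

Record scheme (G : cfg) := Scheme {
  instrumented : {set edge G};
  decode : restricted_profile instrumented -> {ffun G -> bool}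
}.

Definition scheme_size (G : cfg) (S : scheme G) : nat := #|instrumented S|.

Definition valid (G : cfg) (S : scheme G) : Prop :=
  forall tr : seq (seq G), execution_trace tr ->
    decode (restrict (instrumented S) (edge_coverage tr)) = vertex_coverage tr.

(** ** Boolean circuits, used to measure the complexity of decoding maps *)

(* A circuit is a straight-line program; the gate at position [k] refers to
   earlier gates by their positions (a reference to a position [>= k] reads
   [false]). *)
Variant gate (I : Type) :=
  | GConst of bool
  | GInput of I
  | GNot of nat
  | GAnd of nat & nat
  | GOr of nat & nat.

Definition eval_gate (I : Type) (x : I -> bool) (vals : seq bool)
    (g : gate I) : bool :=
  match g with
  | GConst b => b
  | GInput i => x i
  | GNot j => ~~ nth false vals j
  | GAnd j k => nth false vals j && nth false vals k
  | GOr j k => nth false vals j || nth false vals k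
  end.

Definition eval_circuit (I : Type) (c : seq (gate I)) (x : I -> bool) :
    seq bool :=
  foldl (fun vals g => rcons vals (eval_gate x vals g)) [::] c.

Definition circuit_complexity_le (I O : finType) (m : nat)
    (f : {ffun I -> bool} -> {ffun O -> bool}) : Prop :=
  exists (c : seq (gate I)) (out : O -> nat),
    size c <= m /\
    forall (x : {ffun I -> bool}) (v : O),
      f x v = nth false (eval_circuit c x) (out v).

(** ** Ambiguous and inferable vertices *)

Section Inference.
Variable G : cfg.
Implicit Types u v : G.

Definition in_nbrs u : {set G} := [set v | arc v u].
Definition out_nbrs u : {set G} := [set v | arc u v].

(* [u] does not belong to [from_entry u], and [from_entry (entry G)] is empty:
   a path avoiding [u] does not start or end at [u]. Dually for [to_exit]. *)
Definition arc_avoiding u : rel G :=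
  fun x y => [&& arc x y, x != u & y != u].

Definition from_entry u : {set G} :=
  [set v | [&& entry G != u, v != u & connect (arc_avoiding u) (entry G) v]].

Definition to_exit u : {set G} :=
  [set v | [&& v != u, exit G != u & connect (arc_avoiding u) v (exit G)]].

Definition free_in u : {set G} := in_nbrs u :&: from_entry u :&: to_exit u.
Definition free_out u : {set G} := out_nbrs u :&: from_entry u :&: to_exit u.

Definition ambiguous u : bool := (free_in u != set0) && (free_out u != set0).

Definition fwd_inferable u : bool :=
  (out_nbrs u :\: from_entry u != set0) && (free_out u == set0).
Definition bwd_inferable u : bool :=
  (in_nbrs u :\: to_exit u != set0) && (free_in u == set0).

Definition fwd_edge : rel G :=
  fun u v => fwd_inferable u && (v \in out_nbrs u :\: from_entry u).
Definition bwd_edge : rel G :=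
  fun u v => bwd_inferable u && (v \in in_nbrs u :\: to_exit u).
Definition inference_edge : rel G :=
  fun u v => fwd_edge u v || bwd_edge u v.

(* The union of the inference graphs is directed; its components are the
   strongly connected ones. *)
Definition component u : {set G} :=
  [set v | connect inference_edge u v && connect inference_edge v u].

(* [component_path p]: the sequence p = v_1, ..., v_k lists the vertices of a
   component, with forward inference edges (v_i, v_(i+1)) and backward
   inference edges (v_(i+1), v_i). *)
Definition component_path (p : seq G) : bool :=
  if p is u :: q then
    [&& uniq p, path (fun x y => fwd_edge x y && bwd_edge y x) u q
      & [set:: p] == component u]
  else false.

Definition unresolved (p : seq G) : bool :=
  if p is u :: q then
    [&& component_path p, 2 <= size p, ~~ bwd_inferable u
      & ~~ fwd_inferable (last u q)]
  else false.

(** ** The algorithm *)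

Definition in_edges_from (X : {set G}) u : {set edge G} :=
  [set e : edge G | ((val e).1 \in X) && ((val e).2 == u)].
Definition out_edges_to u (Y : {set G}) : {set edge G} :=
  [set e : edge G | ((val e).1 == u) && ((val e).2 \in Y)].

(* [use_in u] tells which of the two edge sets is instrumented at [u]; it is
   free when both have the same cardinality. [pick p] is the edge instrumented
   along [p]. *)
Definition local_instrumentation_set (F : {set edge G}) : Prop :=
  exists (use_in : G -> bool) (pick : seq G -> edge G),
    [/\ forall u, ambiguous u ->
          if use_in u then #|free_in u| <= #|free_out u|
          else #|free_out u| <= #|free_in u|,
        forall p, unresolved p -> val (pick p) \in zip p (behead p)
      & forall e : edge G, (e \in F) <->
          (exists2 u, ambiguous u &
             e \in if use_in u then in_edges_from (free_in u) u
                   else out_edges_to u (free_out u)) \/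
          (exists2 p, unresolved p & e = pick p)].

(* If every walk reaching [v] goes through [u], or if every walk leaving [v]
   does, then [u] is covered as soon as [v] is. For an inferable vertex these
   implications, taken over its inference successors, characterize coverage;
   for an ambiguous vertex they complement the instrumented edges, since a walk
   may also enter [u] from in_nbrs u :\: to_exit u, or leave it to
   out_nbrs u :\: from_entry u. *)
Definition infers u v : bool :=
  inference_edge u v ||
  ambiguous u &&
    (v \in (out_nbrs u :\: from_entry u) :|: (in_nbrs u :\: to_exit u)).

Definition infer_step (F : {set edge G}) (c : restricted_profile F)
    (S : {set G}) : {set G} :=
  [set u | [exists e, c e && ((u == (val (val e)).1) || (u == (val (val e)).2))]
        || [exists v in S, infers u v]].

Definition inferred_coverage (F : {set edge G}) (c : restricted_profile F) :
    {ffun G -> bool} :=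
  [ffun u => u \in fixset (infer_step c)].

Definition local_instrumentation (S : scheme G) : Prop :=
  exists2 F, local_instrumentation_set F & S = Scheme (@inferred_coverage F).

End Inference.

(* Main.v *)
From HB Require Import structures.
From mathcomp Require Import all_boot.
(* After all_boot, whose [path.arc] would shadow the arc relation of a cfg. *)
Require Import Defs.

(* Up to self-loops, an inference step from [u] follows an arc to a vertex
   dominated by [u], or an arc back to one postdominated by [u]. Any cycle of
   such steps consists of mutual steps, in which [u] dominates [v], [v]
   postdominates [u] and [u -> v] is an arc. As a vertex has at most one mutual
   successor and at most one mutual predecessor, the components are paths and
   an ambiguous vertex is alone in its component.

   Validity: among the covered vertices that are not inferred, take one from
   which the fewest vertices are reachable by steps. All steps from it to
   covered vertices are mutual, so its component is unresolved and the walks of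
   the trace follow it, including its instrumented edge.

   Approximation: let [x] be a free in-neighbour of the first and [y] a free
   out-neighbour of the last vertex of a component. Adding a walk through [x],
   the component and [y] to two detours that avoid the component changes the
   vertex coverage, so a valid scheme instruments one of the arcs from [x],
   along the component, or to [y]; at the entry there is no [x], at the exit no
   [y]. Charge each component to the arcs of the valid scheme that are incident
   with it; an arc meets at most two components. *)

Set Implicit Arguments.
Unset Strict Implicit.
Unset Printing Implicit Defensive.

(** * Arcs of a path, and paths that avoid a vertex *)

Definition steps (T : Type) (x : T) (p : seq T) : seq (T * T) := zip (x :: p) p.

Lemma steps_cat (T : Type) (x : T) p q :
  steps x (p ++ q) = steps x p ++ steps (last x p) q.
Proof.
elim: p x => //= y p IHp x.
by rewrite /steps /= -/(steps y (p ++ q)) IHp.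
Qed.

Lemma steps_cons (T : Type) (x y : T) p :
  steps x (y :: p) = (x, y) :: steps y p.
Proof. by []. Qed.

Lemma steps_rel (T : eqType) (e : rel T) x p a :
  path e x p -> a \in steps x p -> e a.1 a.2.
Proof.
elim: p x => [|y p IHp] x //= /andP[exy pp].
by rewrite steps_cons inE => /predU1P[->|] //; apply: IHp.
Qed.

Lemma mem_steps (T : eqType) (x : T) p a :
  a \in steps x p -> (a.1 \in x :: p) && (a.2 \in p).
Proof.
elim: p x => [|y p IHp] x //; rewrite steps_cons inE => /predU1P[->|/IHp].
  by rewrite !inE !eqxx.
by rewrite !inE => /andP[/orP[]-> ->]; rewrite ?orbT.
Qed.

Definition avoiding (T : eqType) (e : rel T) (u : T) : rel T :=
  fun x y => [&& e x y, x != u & y != u].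

Lemma connect_avoidingP (T : finType) (e : rel T) (u x y : T) :
  reflect (exists p, [/\ path e x p, last x p = y & u \notin x :: p])
          ((x != u) && connect (avoiding e u) x y).
Proof.
apply: (iffP andP) => [[xu /connectP[p pp ->]]|[p [pp <- up]]].
  exists p; split=> //.
    by apply: sub_path pp => a b /and3P[].
  rewrite inE negb_or eq_sym xu /=.
  elim: p x xu pp => //= y' p IHp x xu /andP[/and3P[_ _ yu] pp].
  by rewrite inE negb_or eq_sym yu /= (IHp y').
move: up; rewrite inE negb_or eq_sym => /andP[xu up]; split=> //.
apply/connectP; exists p => //.
elim: p x xu pp up => //= y' p IHp x xu /andP[exy pp].
rewrite inE negb_or eq_sym => /andP[yu up]; rewrite /avoiding exy xu yu /=.
exact: IHp.
Qed.

(** * Dominance *)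

Section Dominance.

Variables (T : finType) (e : rel T) (s : T).
Hypothesis reach : forall u, connect e s u.

(** Kept over an arbitrary rooted graph, so that postdominance becomes an instance. The negation
    matches [from_entry], and makes [dom u u] hold for every [u]. *)
Definition dom (u v : T) : bool :=
  ~~ [&& s != u, v != u & connect (avoiding e u) s v].

Lemma ndomP u v :
  reflect (exists p, [/\ path e s p, last s p = v & u \notin s :: p])
          (~~ dom u v).
Proof.
rewrite /dom negbK; apply: (iffP idP) => [/and3P[su _ cv]|[p [pp lp up]]].
  by apply/connect_avoidingP; rewrite su.
have /connect_avoidingP/andP[su cv] :
  exists p, [/\ path e s p, last s p = v & u \notin s :: p] by exists p.
by rewrite su cv andbT /=; apply: contraNneq up => <-; rewrite -lp mem_last.
Qed.

Lemma dom_pred u x v : dom u v -> e x v -> v != u -> dom u x.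
Proof.
move=> duv exv vu; apply: contraLR duv => /ndomP[p [pp lp up]].
apply/ndomP; exists (rcons p v); rewrite rcons_path pp lp exv last_rcons.
by split=> //; rewrite -rcons_cons mem_rcons inE negb_or eq_sym vu.
Qed.

Lemma dom_trans : transitive dom.
Proof.
move=> v u w duv dvw; apply: contraLR duv => /ndomP[p [pp lp up]].
apply/ndomP; have vp : v \in s :: p.
  by apply: contraLR dvw => vp; apply/ndomP; exists p.
case/splitPl: vp pp up lp => p1 p2 l1; rewrite cat_path => /andP[pp1 _] up _.
by exists p1; split=> //; apply: contra up; rewrite -cat_cons mem_cat => ->.
Qed.

(** If [v] dominates [u], a simple path to [u] meets [v]. When [u != v] its prefix up to [v] avoids
    [u], which occurs only at the end, so [u] does not dominate [v]. *)
Lemma dom_antisym u v : dom u v -> dom v u -> u = v.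
Proof.
move=> duv dvu; apply/eqP; apply: contraLR duv => uv.
have /connectP[p0 pp0 l0] := reach u.
case/shortenP: pp0 l0 => p pp Up _ lp.
have vp : v \in s :: p.
  by apply: contraLR dvu => vp; apply/ndomP; exists p.
case/splitPl: vp pp Up lp => p1 p2 l1; rewrite cat_path last_cat.
move=> /andP[pp1 _] Up lp; apply/ndomP; exists p1; split=> //.
move: Up; rewrite -cat_cons cat_uniq => /and3P[_ /hasPn Up _].
apply: Up; rewrite lp l1; case: (p2) lp => [|y q] /= lp; last exact: mem_last.
by rewrite lp l1 eqxx in uv.
Qed.

End Dominance.

(* [D] and [P] stand for dominance and postdominance; this makes reversing the
   graph a mere exchange of [D] and [P]. *)
Section MutualEdges.

Variable T : finType.

Definition dom_edge (e D : rel T) : rel T := fun u v =>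
  [&& e u v, D u v & u != v].
Definition pdom_edge (e P : rel T) : rel T := fun u x =>
  [&& e x u, P u x & u != x].
Definition any_edge (e D P : rel T) : rel T :=
  fun u v => dom_edge e D u v || pdom_edge e P u v.
Definition mutual_edge (e D P : rel T) : rel T :=
  fun u v => [&& e u v, D u v, P v u & u != v].

Definition dominance_order (e D : rel T) :=
  [/\ transitive D, forall u v, D u v -> D v u -> u = v
    & forall u x v, D u v -> e x v -> v != u -> D u x].

(** Strict dominance by [c] survives every step that does not land on [c]: a [dom_edge] by
    transitivity, a [pdom_edge] because it goes back along an arc. *)
Lemma any_edge_dom e D P c z p :
  dominance_order e D -> D c z -> c != z -> path (any_edge e D P) z p ->
  c \notin p -> D c (last z p) && (c != last z p).
Proof.
move=> [Dt _ Da]; elim: p z => [|y p IHp] z Dz cz /=; first by rewrite Dz cz.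
case/andP=> Hzy pp; rewrite inE negb_or => /andP[cy cp]; apply: IHp => //.
case/orP: Hzy => /and3P[ezy Dzy _]; first exact: Dt Dzy.
by apply: (Da c y z) => //; rewrite eq_sym.
Qed.

Lemma any_edgeC e D P u v :
  any_edge (fun x y => e y x) P D u v = any_edge e D P u v.
Proof. exact: orbC. Qed.

(* A cycle of [any_edge] through a [dom_edge] closes up immediately: its last
   step into [u] must come from a postdominator [y] of [u], and leaving
   [v != y] in either direction traps the cycle below [v]. *)
Lemma dom_edge_cycle e D P u v :
  dominance_order e D -> dominance_order (fun x y => e y x) P ->
  dom_edge e D u v -> connect (any_edge e D P) v u -> mutual_edge e D P u v.
Proof.
move=> oD oP Huv /connectP[p0 pp0 l0].
case/shortenP: pp0 l0 => p pp Up _ lp.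
have [[Dt Das Da] [Pt Pas Pa]] := (oD, oP).
have /and3P[euv Duv uv] := Huv.
case/lastP: p pp Up lp => [|p u'] /=; first by move=> _ _ E;
  rewrite E eqxx in uv.
rewrite last_rcons rcons_path mem_rcons rcons_uniq inE negb_or => /andP[pp Hyu].
case/and3P=> /andP[vu' vp] up Up Eu; subst u'.
have /andP[Duy uy] := any_edge_dom oD Duv uv pp up.
have {Hyu} /and3P[euy Pyu yu]: pdom_edge e P (last v p) u.
  case/orP: Hyu => // /and3P[_ Dyu _].
  by rewrite (Das _ _ Duy Dyu) eqxx in uy.
case: p => [|z p] in pp vp up Up Duy uy euy Pyu yu *.
  by rewrite /mutual_edge euv Duv Pyu uv.
move: pp vp => /= /andP[Hvz pp]; rewrite inE negb_or => /andP[vz vp].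
(* If the step from [v] is a [dom_edge], then [v] strictly dominates [last v p], hence also its
   predecessor [u], against [Duv]. Otherwise [v] strictly postdominates [last v p], which in turn
   postdominates [u] and hence its successor [v]. *)
case/orP: Hvz => /and3P[ezv Xvz _].
  have pp' : path (any_edge e D P) z p by [].
  have /andP[Dvy vy] := any_edge_dom oD Xvz vz pp' vp.
  have Dvu : D v u by apply: (Da v u (last z p)); rewrite // eq_sym.
  by rewrite (Das _ _ Duv Dvu) eqxx in uv.
have pp' : path (any_edge (fun x y => e y x) P D) z p.
  by rewrite (eq_path (any_edgeC e D P)).
have /andP[Pvy vy] := any_edge_dom oP Xvz vz pp' vp.
have Pyv : P (last z p) v by apply: (Pa _ v u).
by rewrite (Pas _ _ Pvy Pyv) eqxx in vy.
Qed.

(** A [pdom_edge] is a [dom_edge] of the reversed graph with [D] and [P] exchanged; reversal also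
    turns the mutual edge around. *)
Lemma any_edge_cycle e D P u v :
  dominance_order e D -> dominance_order (fun x y => e y x) P ->
  any_edge e D P u v -> connect (any_edge e D P) v u ->
  mutual_edge e D P u v || mutual_edge e D P v u.
Proof.
move=> oD oP /orP[Huv|Huv] cvu.
  by rewrite (dom_edge_cycle oD oP Huv cvu).
apply/orP; right; move: cvu.
rewrite (eq_connect (fun x y => esym (any_edgeC e D P x y))) => cvu.
have /and4P[? ? ? ?] := dom_edge_cycle oP oD Huv cvu.
by apply/and4P; split; rewrite // eq_sym.
Qed.

(** Since [v] postdominates [u], it postdominates the successor [w] of [u]; by symmetry [w]
    postdominates [v]. *)
Lemma mutual_edge_inj e D P u v w :
  dominance_order (fun x y => e y x) P ->
  mutual_edge e D P u v -> mutual_edge e D P u w -> v = w.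
Proof.
move=> [_ Pas Pa] /and4P[euv _ Pvu uv] /and4P[euw _ Pwu uw].
by apply: Pas; [apply: Pa euw _ | apply: Pa euv _].
Qed.

Lemma mutual_edge_injr e D P u v w :
  dominance_order e D ->
  mutual_edge e D P v u -> mutual_edge e D P w u -> v = w.
Proof.
move=> [_ Das Da] /and4P[evu Dvu _ vu] /and4P[ewu Dwu _ wu].
by apply: Das; [apply: (Da v w u) => // | apply: (Da w v u) => //];
  rewrite eq_sym.
Qed.

End MutualEdges.

(** * Neighbours on a path, and maximal paths *)

Lemma path_succ (T : eqType) (e : rel T) x q y :
  path e x q -> y \in x :: q -> y = last x q \/ exists2 z, z \in q & e y z.
Proof.
elim: q x => [|x' q IHq] x /=; first by move=> _; rewrite inE => /eqP; left.
case/andP=> exx' pq; rewrite inE => /predU1P[->|].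
  by right; exists x'; rewrite ?mem_head.
by case/(IHq _ pq) => [|[z zq eyz]]; [left | right; exists z;
  rewrite // inE zq orbT].
Qed.

Lemma path_pred (T : eqType) (e : rel T) x q y :
  path e x q -> y \in x :: q -> y = x \/ exists2 z, z \in x :: q & e z y.
Proof.
elim: q x => [|x' q IHq] x /=; first by move=> _; rewrite inE => /eqP; left.
case/andP=> exx' pq; rewrite inE => /predU1P[->|]; first by left.
case/(IHq _ pq) => [->|[z zq eyz]]; right; first by exists x; rewrite ?mem_head.
by exists z; rewrite // inE zq orbT.
Qed.

Lemma maximal_path (T : finType) (e : rel T) (f : T -> nat) x :
  (forall y z, e y z -> f z < f y) ->
  exists q, path e x q /\ forall y, ~~ e (last x q) y.
Proof.
move=> fP; have [n] := ubnP (f x); elim: n x => // n IHn x lt_n.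
case: (pickP (e x)) => [y exy|ex0]; last by exists [::]; split=> // y;
  rewrite /= ex0.
have [q [pq lq]] := IHn y (leq_trans (fP _ _ exy) lt_n).
by exists (y :: q); rewrite /= exy.
Qed.

Lemma ltn_card_sub (T : finType) (P Q : {pred T}) x :
  {subset P <= Q} -> x \in Q -> x \notin P -> #|P| < #|Q|.
Proof.
move=> sPQ Qx Px; apply/proper_card/properP.
by split; [apply/subsetP | exists x].
Qed.

(** * Inference components *)

Section ControlFlow.

Variable G : cfg.
Implicit Types (u v x y : G) (p q : seq G).

Let co_arc : rel G := fun x y => arc y x.

Lemma from_entryP u v :
  reflect (exists p, [/\ path (@arc G) (entry G) p, last (entry G) p = v
                       & u \notin entry G :: p])
          (v \in from_entry u).
Proof.
apply: (iffP idP) => [|[p Hp]].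
  by rewrite inE => Av; apply/ndomP; rewrite negbK.
by rewrite inE; apply/negbNE/ndomP; exists p.
Qed.

Lemma to_exitP u v :
  reflect (exists p, [/\ path (@arc G) v p, last v p = exit G
                       & u \notin v :: p])
          (v \in to_exit u).
Proof.
rewrite inE; apply: (iffP and3P) => [[vu _ cv]|[p [pp lp up]]].
  by apply/connect_avoidingP; rewrite vu.
have /connect_avoidingP/andP[vu cv] :
  exists p, [/\ path (@arc G) v p, last v p = exit G &
    u \notin v :: p] by exists p.
by split=> //; apply: contraNneq up => <-; rewrite -lp mem_last.
Qed.

Definition dominates : rel G := fun u v => v \notin from_entry u.
Definition postdominates : rel G := fun u v => v \notin to_exit u.

Lemma dominates_order : dominance_order (@arc G) dominates.
Proof.
have E u v : dominates u v = dom (@arc G) (entry G) u v.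
  by rewrite /dominates inE.
split=> [v u w|u v|u x v]; rewrite !E.
- exact: dom_trans.
- exact/dom_antisym/entry_reaches.
- exact: dom_pred.
Qed.

(** Postdominance is dominance from the exit in the reversed graph. *)
Lemma postdominates_order :
  dominance_order (fun x y => @arc G y x) postdominates.
Proof.
have E u v : postdominates u v = dom co_arc (exit G) u v.
  rewrite /postdominates inE andbCA; congr (~~ [&& _, _ & _]).
  have /= <- := connect_rev (arc_avoiding u) (exit G) v.
  apply: eq_connect => a b; rewrite /= /arc_avoiding /avoiding /co_arc.
  by rewrite [(b != u) && _]andbC.
have reach u : connect co_arc (exit G) u.
  by have /= -> := connect_rev (@arc G) (exit G) u; apply: reaches_exit.
split=> [v u w|u v|u x v]; rewrite !E.
- exact: dom_trans.
- exact/dom_antisym.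
- by apply: (dom_pred (e := co_arc)).
Qed.

Definition order_edge : rel G := any_edge (@arc G) dominates postdominates.
Definition mutual : rel G := mutual_edge (@arc G) dominates postdominates.

Lemma dominatesxx u : dominates u u.
Proof. by rewrite /dominates inE eqxx andbF. Qed.

Lemma postdominatesxx u : postdominates u u.
Proof. by rewrite /postdominates inE eqxx. Qed.

(* A walk from [s] to [v] and then to [t] that avoids [u] meets every
   postdominator of [v] after leaving [v]. *)
Lemma from_entry_postdominator u v y :
  v \in from_entry u -> v \in to_exit u -> postdominates y v ->
  y \in from_entry u.
Proof.
move=> /from_entryP[p [pp lp up]] /to_exitP[q [pq lq uq]] Pyv.
have yq : y \in v :: q.
  by apply: contraLR Pyv => yq; rewrite negbK; apply/to_exitP; exists q.
case/splitPl: yq pq lq uq => q1 q2 l1; rewrite cat_path => /andP[pq1 _] _ uq.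
apply/from_entryP; exists (p ++ q1); rewrite cat_path last_cat pp lp.
split=> //; move: up uq; rewrite -!cat_cons !mem_cat !inE !negb_or.
by move=> -> /andP[/andP[_ ->]].
Qed.

(** A walk through [v] that avoids [u] meets every dominator of [v] before [v], and goes on from
    there to the exit. *)
Lemma to_exit_dominator u v x :
  v \in from_entry u -> v \in to_exit u -> dominates x v -> x \in to_exit u.
Proof.
move=> /from_entryP[p [pp lp up]] /to_exitP[q [pq lq uq]] Dxv.
have xp : x \in entry G :: p.
  by apply: contraLR Dxv => xp; rewrite negbK; apply/from_entryP; exists p.
case/splitPl: xp pp lp up => p1 p2 l1; rewrite cat_path last_cat l1.
move=> /andP[_ pp2] l2 up; apply/to_exitP; exists (p2 ++ q).
rewrite cat_path last_cat pp2 l2; split=> //.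
have ux : u != x.
  by apply: contraNneq up => ->; rewrite -cat_cons mem_cat -l1 mem_last.
move: up uq; rewrite -!cat_cons !mem_cat !inE !negb_or ux.
by case/andP=> _ -> /andP[].
Qed.

Lemma mutual_irr u v : mutual u v -> u != v.
Proof. by case/and4P. Qed.

(** Every out-neighbour of [u] is postdominated by [v]. A free one would thus give a path from the
    entry to [v] that avoids [u], although [u] dominates [v]. *)
Lemma mutual_free_out u v : mutual u v -> free_out u = set0.
Proof.
case/and4P=> euv Duv Pvu uv; apply/setP=> w;
  rewrite in_set0 in_setI in_setI inE.
apply/negP=> /andP[/andP[euw Aw] Bw]; move/negP: Duv; apply.
have [_ _ Pa] := postdominates_order.
by apply: from_entry_postdominator Aw Bw _; apply: (Pa v w u).
Qed.

Lemma mutual_free_in u v : mutual u v -> free_in v = set0.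
Proof.
case/and4P=> euv Duv Pvu uv; apply/setP=> w;
  rewrite in_set0 in_setI in_setI inE.
apply/negP=> /andP[/andP[ewv Aw] Bw]; move/negP: Pvu; apply.
have [_ _ Da] := dominates_order.
by apply: to_exit_dominator Aw Bw _; apply: (Da u w v); rewrite // eq_sym.
Qed.

Lemma mutual_fwd_edge u v : mutual u v -> fwd_edge u v.
Proof.
move=> Muv; have /and4P[euv Duv _ _] := Muv.
rewrite /fwd_edge /fwd_inferable (mutual_free_out Muv) eqxx andbT.
have vout : v \in out_nbrs u :\: from_entry u by apply/setDP; split;
  rewrite // inE.
by rewrite vout andbT; apply/set0Pn; exists v.
Qed.

Lemma mutual_bwd_edge u v : mutual u v -> bwd_edge v u.
Proof.
move=> Muv; have /and4P[euv _ Pvu _] := Muv.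
rewrite /bwd_edge /bwd_inferable (mutual_free_in Muv) eqxx andbT.
have uin : u \in in_nbrs v :\: to_exit v by apply/setDP; split; rewrite // inE.
by rewrite uin andbT; apply/set0Pn; exists u.
Qed.

(** Forgets the inferability and ambiguity guards and keeps only the order. Self-loops are excluded:
    since [u] is never in [from_entry u], a loop at [u] can count as an inference edge. *)
Lemma infers_any_edge u v : infers u v -> u != v -> order_edge u v.
Proof.
move=> iuv uv; suff:
  v \in out_nbrs u :\: from_entry u \/ v \in in_nbrs u :\: to_exit u.
  rewrite /order_edge /any_edge /dom_edge /pdom_edge uv !andbT.
  case=> /setDP[]; rewrite inE => -> nv; apply/orP; [by left | by right].
case/orP: iuv => [/orP[/andP[_]|/andP[_]]|/andP[_]]; [by left | by right |].
by rewrite in_setU => /orP.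
Qed.

Lemma inference_infers u v : inference_edge u v -> infers u v.
Proof. by rewrite /infers => ->. Qed.

Lemma mutual_inference u v :
  mutual u v -> inference_edge u v && inference_edge v u.
Proof.
move=> Muv; rewrite /inference_edge (mutual_fwd_edge Muv) (mutual_bwd_edge Muv).
by rewrite orbT.
Qed.

Lemma mutual_cycle u v :
  order_edge u v -> connect order_edge v u -> mutual u v || mutual v u.
Proof. exact: any_edge_cycle dominates_order postdominates_order. Qed.

(** Dropping the guards does not enlarge components: an [order_edge] on a cycle is mutual in one
    direction, and a mutual edge is an inference edge both ways. *)
Lemma componentE u :
  component u = [set v | connect order_edge u v && connect order_edge v u].
Proof.
have sIH x y : connect (@inference_edge G) x y -> connect order_edge x y.
  apply: connect_sub x y => x y ixy; case: (eqVneq x y) => [->|xy] //.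
  exact/connect1/infers_any_edge/xy/inference_infers.
have sHI x y : connect order_edge x y -> connect order_edge y x ->
  connect (@inference_edge G) x y.
  move=> /connectP[p pp ->]; elim: p x pp => //= z p IHp x /andP[Hxz pp] cx.
  have czx : connect order_edge z x.
    by apply: connect_trans cx; apply/connectP; exists p.
  apply: connect_trans (IHp z pp (connect_trans cx (connect1 Hxz))).
  by case/orP: (mutual_cycle Hxz czx) => /mutual_inference/andP[? ?];
    apply: connect1.
apply/setP=> v; rewrite !inE; apply/andP/andP=> [[/sIH-> /sIH->]|[c1 c2]] //.
by rewrite !sHI.
Qed.

(** Steps inside a component lie on cycles, hence are mutual in one direction; closure under
    [mutual] is therefore enough. *)
Lemma component_sub u (S : {set G}) :
  u \in S -> (forall v w, mutual v w -> (v \in S) = (w \in S)) ->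
  component u \subset S.
Proof.
move=> Su SP; apply/subsetP=> v;
  rewrite componentE inE => /andP[/connectP[p pp ->]].
elim: p u Su pp => //= z p IHp u Su /andP[Huz pp] cu.
have czu : connect order_edge z u by apply: connect_trans cu; apply/connectP;
  exists p.
apply: IHp (connect_trans cu (connect1 Huz)) => //.
by case/orP: (mutual_cycle Huz czu) => /SP; rewrite Su.
Qed.

Lemma component_mutual u v w :
  mutual v w -> (v \in component u) = (w \in component u).
Proof.
case/mutual_inference/andP=> /connect1 cvw /connect1 cwv; rewrite !inE.
apply/andP/andP=> -[c1 c2]; split.
- exact: connect_trans c1 cvw.
- exact: connect_trans cwv c2.
- exact: connect_trans c1 cwv.
- exact: connect_trans cvw c2.
Qed.

Lemma component_eq u v : v \in component u -> component v = component u.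
Proof.
rewrite inE => /andP[cuv cvu]; apply/setP=> w; rewrite !inE.
apply/andP/andP=> -[c1 c2]; split.
- exact: connect_trans cuv c1.
- exact: connect_trans c2 cvu.
- exact: connect_trans cvu c1.
- exact: connect_trans c2 cuv.
Qed.

Lemma componentxx u : u \in component u.
Proof. by rewrite inE connect0. Qed.

Definition strictly_dominates : rel G := fun u v => dominates u v && (u != v).

Lemma strictly_dominates_trans : transitive strictly_dominates.
Proof.
have [Dt Das _] := dominates_order.
move=> v u w /andP[Duv uv] /andP[Dvw vw]; rewrite /strictly_dominates.
rewrite (Dt _ _ _ Duv Dvw); apply: contraNneq uv => E; subst w.
by apply/eqP/Das.
Qed.

Lemma mutual_path_sorted u q :
  path mutual u q -> sorted strictly_dominates (u :: q).
Proof.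
by apply: sub_path => x y /and4P[_ Dxy _ xy]; rewrite /strictly_dominates Dxy.
Qed.

Lemma strictly_dominates_irr : irreflexive strictly_dominates.
Proof. by move=> u; rewrite /strictly_dominates eqxx andbF. Qed.

Lemma mutual_path_uniq u q : path mutual u q -> uniq (u :: q).
Proof.
move/mutual_path_sorted; apply: sorted_uniq strictly_dominates_irr _.
exact: strictly_dominates_trans.
Qed.

Lemma mutual_path_component u v q :
  path mutual v q -> v \in component u -> {subset v :: q <= component u}.
Proof.
elim: q v => [|w q IHq] v /=; first by move=> _ uv x; rewrite inE => /eqP->.
case/andP=> Mvw pq uv x; rewrite inE => /predU1P[->|] //.
by apply: IHq => //; rewrite -(component_mutual u Mvw).
Qed.

Lemma mutual_path_last u v q :
  path (fun x y => mutual y x) v q -> v \in component u ->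
  last v q \in component u.
Proof.
elim: q v => [|w q IHq] v //= /andP[Mwv pq] uv.
by apply: IHq => //; rewrite (component_mutual u Mwv).
Qed.

(** Mutual successors and predecessors are unique, so a path that extends at neither end is closed
    under [mutual] in both directions. *)
Lemma maximal_mutual_path v q :
  path mutual v q -> (forall x, ~~ mutual x v) ->
  (forall y, ~~ mutual (last v q) y) ->
  [set:: v :: q] = component v.
Proof.
move=> pq nv nl; apply/eqP; rewrite eqEsubset; apply/andP; split.
  by apply/subsetP=> x; rewrite inE;
    apply: mutual_path_component pq (componentxx v) _.
apply: component_sub => [|a b Mab]; first by rewrite inE mem_head.
rewrite [a \in _]inE [b \in _]inE; apply/idP/idP=> [ap|bp].
  case: (path_succ pq ap) => [E|[z zq Maz]];
    first by rewrite E (negPf (nl _)) in Mab.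
  by rewrite (mutual_edge_inj postdominates_order Mab Maz) inE zq orbT.
case: (path_pred pq bp) => [E|[z zp Mzb]];
  first by rewrite E (negPf (nv _)) in Mab.
by rewrite (mutual_edge_injr dominates_order Mab Mzb).
Qed.

Lemma exists_component_path u :
  exists v q, [/\ u \in v :: q, component_path (v :: q), path mutual v q,
                  forall x, ~~ mutual x v & forall y, ~~ mutual (last v q) y].
Proof.
have [Dt Das _] := dominates_order; have [Pt Pas _] := postdominates_order.
(* Go back from [u] along mutual edges as far as possible; each step back loses a dominator. *)
have [q0 [pq0 lq0]] : exists q, path (fun x y => mutual y x) u q
                               /\ forall y, ~~ mutual y (last u q).
  apply: (@maximal_path _ _ (fun v => #|[pred x | dominates x v]|)).
  move=> v w /and4P[_ Dwv _ wv]; apply: (@ltn_card_sub _ _ _ v).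
  - by move=> x; rewrite !inE => Dxw; apply: Dt Dwv.
  - by rewrite inE dominatesxx.
  - by rewrite inE; apply: contraNN wv => Dvw; apply/eqP/Das.
set v := last u q0 in lq0.
(* From the first vertex go forward as far as possible; each step forward loses a postdominator. *)
have [q [pq lq]] :
    exists q, path mutual v q /\ forall y, ~~ mutual (last v q) y.
  apply: (@maximal_path _ _ (fun v => #|[pred x | postdominates x v]|)).
  move=> x w /and4P[_ _ Pwx wx]; apply: (@ltn_card_sub _ _ _ x).
  - by move=> z; rewrite !inE => Pzw; apply: Pt Pwx.
  - by rewrite inE postdominatesxx.
  - by rewrite inE; apply: contraNN wx => Pvw; apply/eqP/Pas.
have vu : v \in component u by apply: mutual_path_last pq0 (componentxx u).
have Ep := maximal_mutual_path pq lq0 lq.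
exists v, q; split=> //.
  have: u \in [set:: v :: q] by rewrite Ep (component_eq vu) componentxx.
  by rewrite inE.
rewrite /component_path mutual_path_uniq // Ep eqxx andbT.
by apply: sub_path pq => x y Mxy; rewrite mutual_fwd_edge ?mutual_bwd_edge.
Qed.

Lemma component_path_mutual v q : component_path (v :: q) -> path mutual v q.
Proof.
case/and3P=> Uq pq _; elim: q v Uq pq => //= w q IHq v.
rewrite inE negb_or => /andP[/andP[vw _] Uq] /andP[/andP[fvw bwv] pq].
rewrite IHq // andbT /mutual /mutual_edge vw andbT.
move: fvw bwv => /andP[_ /setDP[evw Dvw]] /andP[_ /setDP[_ Pwv]].
by rewrite inE in evw; apply/and3P.
Qed.

(** Both paths are sorted by strict dominance, so the vertex set determines the order. Hence a
    component receives a single [pick]. *)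
Lemma component_path_eq v q v' q' :
  component_path (v :: q) -> component_path (v' :: q') ->
  v :: q =i v' :: q' -> v :: q = v' :: q'.
Proof.
move=> /component_path_mutual/mutual_path_sorted Sp.
move=> /component_path_mutual/mutual_path_sorted Sp'.
apply: irr_sorted_eq Sp Sp'; first exact: strictly_dominates_trans.
exact: strictly_dominates_irr.
Qed.

Lemma mutual_not_ambiguous u v : mutual u v -> ~~ ambiguous u && ~~ ambiguous v.
Proof.
move=> Muv; rewrite /ambiguous (mutual_free_out Muv) (mutual_free_in Muv) eqxx.
by rewrite andbF.
Qed.

(** On a component path with at least two vertices, each vertex has a mutual neighbour, which rules
    out ambiguity. *)
Lemma ambiguous_component u : ambiguous u -> component u = [set u].
Proof.
move=> au; have [v [q [uq /and3P[_ _ /eqP E] pq _ _]]] :=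
  exists_component_path u.
have Ev : component v = component u by apply/esym/component_eq; rewrite -E inE.
case: q => [|w q] in uq E pq *.
  by move: uq; rewrite inE => /eqP->; rewrite -E; apply/setP=> x; rewrite !inE.
case: (path_succ pq uq) => [El|[z _ /mutual_not_ambiguous]]; last by rewrite au.
case: (path_pred pq uq) => [Eu|[z _ /mutual_not_ambiguous]];
  last by rewrite au andbF.
by move: pq; rewrite -{}Eu /= => /andP[/mutual_not_ambiguous]; rewrite au.
Qed.

End ControlFlow.

(** * Walks and coverage *)

Section Walks.

Variable G : cfg.
Implicit Types (u v x y : G) (p q w : seq G) (tr : seq (seq G)).

(** Take the last visit to [u]: the rest of the path avoids [u] and witnesses membership in
    [to_exit u]. *)
Lemma last_step_from u x p :
  path (@arc G) x p -> last x p = exit G -> u \in x :: p -> u != exit G ->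
  exists2 v, v \in to_exit u & (u, v) \in steps x p.
Proof.
elim: p x => [|y p IHp] x /= pp lp; first by rewrite inE lp => /eqP-> /eqP.
rewrite inE steps_cons => ux ut; case/andP: pp => exy pp.
have [uy|uy] := boolP (u \in y :: p).
  by have [v Bv sv] := IHp y pp lp uy ut; exists v; rewrite // inE sv orbT.
move: ux; rewrite (negPf uy) orbF => /eqP E; subst x.
by exists y; rewrite ?mem_head //; apply/to_exitP; exists p.
Qed.

Lemma in_free_in u v :
  (v \in free_in u) = [&& arc v u, v \in from_entry u & v \in to_exit u].
Proof. by rewrite 2!in_setI -andbA; congr (_ && _); rewrite inE. Qed.

Lemma in_free_out u v :
  (v \in free_out u) = [&& arc u v, v \in from_entry u & v \in to_exit u].
Proof. by rewrite 2!in_setI -andbA; congr (_ && _); rewrite inE. Qed.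

Lemma from_entry_neq u v : v \in from_entry u -> v != u.
Proof. by rewrite inE => /and3P[]. Qed.

Lemma to_exit_neq u v : v \in to_exit u -> v != u.
Proof. by rewrite inE => /and3P[]. Qed.

(** Until its first visit to [u], the path stays inside [from_entry u]. *)
Lemma first_step_into u x p :
  path (@arc G) x p -> x \in from_entry u -> u \in x :: p ->
  exists2 v, v \in from_entry u & (v, u) \in steps x p.
Proof.
elim: p x => [|y p IHp] x /= pp Ax.
  by rewrite inE => /eqP E; move: (from_entry_neq Ax); rewrite E eqxx.
rewrite inE steps_cons => /predU1P[E|].
  by move: (from_entry_neq Ax); rewrite E eqxx.
move=> uy; case/andP: pp => exy pp; have [E|yu] := eqVneq y u.
  by subst y; exists x; rewrite ?mem_head.
have Ay : y \in from_entry u.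
  have [_ _ Da] := dominates_order G.
  by apply: contraLR Ax => Dy; apply: (Da u x y).
by have [v Av sv] := IHp y pp Ay uy; exists v; rewrite // inE sv orbT.
Qed.

Lemma entry_from_entry u : u != entry G -> entry G \in from_entry u.
Proof. by move=> us; rewrite inE eq_sym us connect0. Qed.

Lemma exists_in_from_entry u :
  u != entry G -> exists2 v, v \in in_nbrs u & v \in from_entry u.
Proof.
move=> us; have /connectP[p pp lp] := entry_reaches u.
have up : u \in entry G :: p by rewrite lp mem_last.
have [v Av /(steps_rel pp) evu] := first_step_into pp (entry_from_entry us) up.
by exists v; rewrite // inE.
Qed.

Lemma exists_out_to_exit u :
  u != exit G -> exists2 v, v \in out_nbrs u & v \in to_exit u.
Proof.
move=> ut; have /connectP[p pp lp] := reaches_exit u.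
have [v Bv /(steps_rel pp) euv] :=
  last_step_from pp (esym lp) (mem_head u p) ut.
by exists v; rewrite // inE.
Qed.

(** A path from the entry cannot avoid the entry, so [from_entry (entry G)] is empty; likewise for
    [to_exit (exit G)]. Neither terminal is therefore ambiguous. *)
Lemma free_in_entry : free_in (entry G) = set0.
Proof. by apply/setP=> x; rewrite !inE eqxx !andbF. Qed.

Lemma free_in_exit : free_in (exit G) = set0.
Proof. by apply/setP=> x; rewrite !inE eqxx !andbF. Qed.

Lemma free_out_exit : free_out (exit G) = set0.
Proof. by apply/setP=> x; rewrite !inE eqxx !andbF. Qed.

Lemma free_out_entry : free_out (entry G) = set0.
Proof. by apply/setP=> x; rewrite !inE eqxx !andbF. Qed.

(** A vertex other than the entry has an in-neighbour in [from_entry u]; if none is free, that one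
    lies outside [to_exit u]. *)
Lemma bwd_inferableP u :
  bwd_inferable u = (u != entry G) && (free_in u == set0).
Proof.
rewrite /bwd_inferable; apply: andb_id2r => /eqP fu.
apply/set0Pn/idP=> [[x /setDP[]]|us].
  by rewrite inE => exu _; apply: contraTneq exu => ->; apply: entry_indeg0.
have [v ev Av] := exists_in_from_entry us; exists v; apply/setDP; split=> //.
by move/setP/(_ v): fu; rewrite !in_setI ev Av in_set0 /= => ->.
Qed.

Lemma fwd_inferableP u :
  fwd_inferable u = (u != exit G) && (free_out u == set0).
Proof.
rewrite /fwd_inferable; apply: andb_id2r => /eqP fu.
apply/set0Pn/idP=> [[x /setDP[]]|us].
  by rewrite inE => eux _; apply: contraTneq eux => ->; apply: exit_outdeg0.
have [v ev Bv] := exists_out_to_exit us; exists v; apply/setDP; split=> //.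
by move/setP/(_ v): fu; rewrite !in_setI ev Bv andbT in_set0 /= => ->.
Qed.

Lemma not_ambiguous_inferable u :
  ~~ ambiguous u -> fwd_inferable u || bwd_inferable u.
Proof.
rewrite fwd_inferableP bwd_inferableP /ambiguous negb_and !negbK.
have [->|us] := eqVneq u (entry G);
  first by rewrite entry_neq_exit free_out_entry eqxx.
have [->|ut] := eqVneq u (exit G); first by rewrite free_in_exit eqxx.
by rewrite orbC.
Qed.

Lemma walk_dominates a u w :
  is_walk w -> u \in entry G :: w -> dominates a u -> a \in entry G :: w.
Proof.
case/andP=> pw _ uw; apply: contraLR => aw; rewrite negbK; apply/from_entryP.
case/splitPl: uw pw aw => w1 w2 l1; rewrite cat_path => /andP[pw1 _] aw.
by exists w1; split=> //; apply: contra aw; rewrite -cat_cons mem_cat => ->.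
Qed.

Lemma walk_postdominates a u w :
  is_walk w -> u \in entry G :: w -> postdominates a u -> a \in entry G :: w.
Proof.
case/andP=> pw lw uw; apply: contraLR => aw; rewrite negbK; apply/to_exitP.
case/splitPl: uw pw lw aw => w1 w2 l1.
rewrite cat_path last_cat l1 => /andP[_ pw2] /eqP lw aw.
exists w2; split=> //; apply: contra aw; rewrite -cat_cons mem_cat inE.
by case/predU1P=> [->|->]; rewrite ?orbT // -l1 mem_last.
Qed.

Lemma vertex_coverageP tr u :
  reflect (exists2 w, w \in tr & u \in entry G :: w) (vertex_coverage tr u).
Proof. by rewrite ffunE; apply: hasP. Qed.

(** For [u != v], the vertex [u] dominates or postdominates [v], so every walk through [v] also
    visits [u]. *)
Lemma coverage_infers tr u v :
  execution_trace tr -> infers u v -> vertex_coverage tr v ->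
  vertex_coverage tr u.
Proof.
move=> /allP wtr iuv /vertex_coverageP[w wt vw]; apply/vertex_coverageP;
  exists w => //.
have [->//|uv] := eqVneq u v.
case/orP: (infers_any_edge iuv uv) => /and3P[_ ? _].
  exact: walk_dominates (wtr w wt) vw _.
exact: walk_postdominates (wtr w wt) vw _.
Qed.

End Walks.

(** * Validity *)

Section Inferring.

Variables (G : cfg) (F : {set edge G}).
Implicit Types (u v x y : G) (c : restricted_profile F).

Lemma infer_step_mono c : {homo infer_step c : X Y / X \subset Y}.
Proof.
move=> X Y sXY; apply/subsetP=> u; rewrite !inE => /orP[->//|].
by case/exists_inP=> v Xv iuv; apply/orP; right; apply/exists_inP;
  exists v => //; apply: (subsetP sXY).
Qed.

Lemma inferred_coverageE c u :
  inferred_coverage c u =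
  [exists e, c e && ((u == (val (val e)).1) || (u == (val (val e)).2))]
  || [exists v, inferred_coverage c v && infers u v].
Proof.
rewrite /inferred_coverage ffunE -(fixsetK (infer_step_mono c)) [in LHS]inE.
congr (_ || _); apply: eq_existsb => v.
by rewrite ffunE fixsetK //; apply: infer_step_mono.
Qed.

Lemma inferred_coverage_ind c (S : {set G}) :
  (forall e u, c e -> (u == (val (val e)).1) || (u == (val (val e)).2) ->
     u \in S) ->
  (forall u v, v \in S -> infers u v -> u \in S) ->
  forall u, inferred_coverage c u -> u \in S.
Proof.
move=> Se Si u; rewrite ffunE /fixset.
(* [fixset] iterates the step [#|G|] times from [set0]; the induction is on the number of
   iterations. *)
elim: #|G| u => [|n IHn] u /=; first by rewrite inE.
rewrite inE => /orP[/existsP[e /andP[ce ue]]|/exists_inP[v /IHn Sv iuv]].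
  exact: Se ce ue.
exact: Si Sv iuv.
Qed.

End Inferring.

Section Validity.

Variables (G : cfg) (F : {set edge G}) (use_in : G -> bool).
Variable pick : seq G -> edge G.
Hypothesis pickP : forall p, unresolved p -> val (pick p) \in zip p (behead p).
Hypothesis FP : forall e : edge G, (e \in F) <->
          (exists2 u, ambiguous u &
             e \in if use_in u then in_edges_from (free_in u) u
                   else out_edges_to u (free_out u)) \/
          (exists2 p, unresolved p & e = pick p).
Variable tr : seq (seq G).
Hypothesis trP : execution_trace tr.
Implicit Types (u v x y : G).

Let c := restrict F (edge_coverage tr).
Let covered u := vertex_coverage tr u.
Let inferred u := inferred_coverage c u.

Lemma inferred_covered u : inferred u -> covered u.
Proof.
move=> iu; have: u \in [set v | covered v]; last by rewrite inE.
move: u iu; apply: inferred_coverage_ind => [e u|u v].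
  rewrite !ffunE inE => /hasP[w wt sw] ue; apply/vertex_coverageP;
    exists w => //.
  by have /andP[s1 s2] := mem_steps sw; case/orP: ue => /eqP->;
    rewrite // inE s2 orbT.
by rewrite !inE => cv iuv; apply: coverage_infers iuv cv.
Qed.

Lemma covered_edge_inferred (e : edge G) w :
  e \in F -> w \in tr -> val e \in steps (entry G) w ->
  inferred (val e).1 && inferred (val e).2.
Proof.
move=> eF wt sw; have ce : c (Sub e eF).
  by rewrite ffunE SubK ffunE; apply/hasP; exists w.
rewrite /inferred !inferred_coverageE; apply/andP; split; apply/orP; left.
  by apply/existsP; exists (Sub e eF); rewrite ce SubK eqxx.
by apply/existsP; exists (Sub e eF); rewrite ce SubK eqxx orbT.
Qed.

Lemma inferred_infers u v : infers u v -> inferred v -> inferred u.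
Proof.
move=> iuv iv; rewrite /inferred inferred_coverageE; apply/orP; right.
by apply/existsP; exists v; apply/andP.
Qed.

(** Never grows along [order_edge], and drops whenever the step cannot be undone. *)
Let reached u := #|[pred x | connect (@order_edge G) u x]|.

Section Minimal.

Variable n : nat.
Hypothesis nP : forall u, covered u -> ~~ inferred u -> n <= reached u.

Let minimal : {set G} :=
  [set u | [&& covered u, ~~ inferred u & reached u == n]].

(** If [v] could not get back to [u], it would be a covered vertex that is not inferred and reaches
    fewer vertices than [u]. *)
Lemma minimal_infers u v :
  u \in minimal -> infers u v -> u != v -> covered v ->
  mutual u v || mutual v u.
Proof.
rewrite inE => /and3P[cu iu /eqP ru] iuv uv cv.
have Huv := infers_any_edge iuv uv.
apply: mutual_cycle => //; apply: contraT => ncvu.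
have iv : ~~ inferred v by apply: contra iu; apply: inferred_infers.
have := nP cv iv; rewrite -ru leqNgt => /negP[].
apply: (@ltn_card_sub _ _ _ u); rewrite ?inE ?connect0 //.
by move=> x; rewrite !inE; apply: connect_trans; apply: connect1.
Qed.

Lemma minimal_mutual u v : mutual u v -> (u \in minimal) = (v \in minimal).
Proof.
move=> Muv; have /andP[iuv ivu] := mutual_inference Muv.
have Ec : covered u = covered v.
  by apply/idP/idP; apply: coverage_infers => //; apply: inference_infers.
have Ei : inferred u = inferred v.
  by apply/idP/idP; apply: inferred_infers => //; apply: inference_infers.
have /and4P[_ _ _ uv] := Muv; have vu : v != u by rewrite eq_sym.
have H1 := connect1 (infers_any_edge (inference_infers iuv) uv).
have H2 := connect1 (infers_any_edge (inference_infers ivu) vu).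
rewrite !inE Ec Ei; congr (_ && (_ && (_ == _))).
by apply: eq_card => x; rewrite !inE; apply/idP/idP; apply: connect_trans.
Qed.

(** The last departure of a covering walk from [u] leads into [to_exit u]. As [free_out u] is empty,
    this is an inference edge, hence mutual by minimality. The walk itself is recorded because it
    will have to traverse an instrumented edge. *)
Lemma minimal_fwd u :
  u \in minimal -> fwd_inferable u ->
  exists v w, [/\ mutual u v, w \in tr & (u, v) \in steps (entry G) w].
Proof.
move=> mu fu; move: (fu); rewrite fwd_inferableP => /andP[ut /eqP fo].
have : covered u by move: mu; rewrite inE => /andP[].
case/vertex_coverageP=> w wt uw; have /andP[pw /eqP lw] := allP trP w wt.
have [v Bv sv] := last_step_from pw lw uw ut.
have euv : arc u v by have := steps_rel pw sv.
exists v, w; split=> //.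
have iuv : infers u v.
  apply: inference_infers; rewrite /inference_edge /fwd_edge fu;
  apply/orP; left.
  apply/setDP; split; [by rewrite inE | apply/negP=> Av].
  by move/setP/(_ v): fo; rewrite in_free_out euv Av Bv in_set0.
have uv : u != v by rewrite eq_sym (to_exit_neq Bv).
have cv : covered v.
  by apply/vertex_coverageP; exists w; rewrite // inE;
    have /andP[_ ->] := mem_steps sv; rewrite orbT.
case/orP: (minimal_infers mu iuv uv cv) => // /and4P[_ Dvu Pvu _].
by move: (Pvu); rewrite /postdominates Bv.
Qed.

Lemma minimal_bwd u :
  u \in minimal -> bwd_inferable u -> exists v, mutual v u.
Proof.
move=> mu fu; move: (fu); rewrite bwd_inferableP => /andP[us /eqP fi].
have : covered u by move: mu; rewrite inE => /andP[].
case/vertex_coverageP=> w wt uw; have /andP[pw /eqP lw] := allP trP w wt.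
have [v Av sv] := first_step_into pw (entry_from_entry us) uw.
have evu : arc v u by have := steps_rel pw sv.
exists v.
have iuv : infers u v.
  apply: inference_infers; rewrite /inference_edge /bwd_edge fu;
  apply/orP; right.
  apply/setDP; split; [by rewrite inE | apply/negP=> Bv].
  by move/setP/(_ v): fi; rewrite in_free_in evu Av Bv in_set0.
have uv : u != v by rewrite eq_sym (from_entry_neq Av).
have cv : covered v.
  by apply/vertex_coverageP; exists w; have /andP[] := mem_steps sv.
case/orP: (minimal_infers mu iuv uv cv) => // /and4P[_ Duv _ _].
by move: (Duv); rewrite /dominates Av.
Qed.

(** The first arc of a walk into [u], or the last one out of [u], is either instrumented, so that
    [u] is inferred, or comes from an inference successor of [u]. By minimality the latter would be
    a mutual neighbour, which an ambiguous vertex lacks. *)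
Lemma minimal_not_ambiguous u : u \in minimal -> ~~ ambiguous u.
Proof.
move=> mu; apply/negP=> au.
have [cu iu] : covered u /\ ~~ inferred u by move: mu; rewrite inE => /and3P[].
case/vertex_coverageP: (cu) => w wt uw; have /andP[pw /eqP lw] := allP trP w wt.
have no_mutual v : infers u v -> u != v -> covered v -> False.
  move=> iuv uv cv.
  by case/orP: (minimal_infers mu iuv uv cv) => /mutual_not_ambiguous;
    rewrite au ?andbF.
have [fi fo] := andP au.
case Eu: (use_in u).
  have us : u != entry G by apply: contraNneq fi => ->; rewrite free_in_entry.
  have [v Av sv] := first_step_into pw (entry_from_entry us) uw.
  have evu : arc v u by have := steps_rel pw sv.
  have cv : covered v.
    by apply/vertex_coverageP; exists w; have /andP[] := mem_steps sv.
  have [Bv|Bv] := boolP (v \in to_exit u); last first.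
    apply: no_mutual cv; last by rewrite eq_sym (from_entry_neq Av).
    apply/orP; right; rewrite au in_setU; apply/orP; right.
    by apply/setDP; rewrite inE.
  have eF : (Sub (v, u) evu : edge G) \in F.
    apply/FP; left; exists u => //; rewrite Eu inE SubK eqxx andbT.
    by rewrite in_free_in evu Av Bv.
  by have := covered_edge_inferred eF wt; rewrite SubK => /(_ sv)/andP[_];
    rewrite (negPf iu).
have ut : u != exit G by apply: contraNneq fo => ->; rewrite free_out_exit.
have [v Bv sv] := last_step_from pw lw uw ut.
have euv : arc u v by have := steps_rel pw sv.
have cv : covered v.
  by apply/vertex_coverageP; exists w; rewrite // inE;
    have /andP[_ ->] := mem_steps sv; rewrite orbT.
have [Av|Av] := boolP (v \in from_entry u); last first.
  apply: no_mutual cv; last by rewrite eq_sym (to_exit_neq Bv).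
  apply/orP; right; rewrite au in_setU; apply/orP; left.
  by apply/setDP; rewrite inE.
have eF : (Sub (u, v) euv : edge G) \in F.
  apply/FP; left; exists u => //; rewrite Eu inE SubK eqxx /=.
  by rewrite in_free_out euv Av Bv.
by have := covered_edge_inferred eF wt; rewrite SubK => /(_ sv)/andP[];
  rewrite (negPf iu).
Qed.

Lemma minimal_empty u : u \notin minimal.
Proof.
apply/negP=> mu.
have [x Mux] : exists x, mutual u x || mutual x u.
  case/orP: (not_ambiguous_inferable (minimal_not_ambiguous mu)).
    by case/(minimal_fwd mu)=> x [w [Mux _ _]]; exists x; rewrite Mux.
  by case/(minimal_bwd mu)=> x Mxu; exists x; rewrite Mxu orbT.
have [v [q [uq cp pq nv nl]]] := exists_component_path u.
have Ep : [set:: v :: q] = component v by case/and3P: cp => _ _ /eqP.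
have Ev : component v = component u by apply/esym/component_eq; rewrite -Ep inE.
have mp : {subset v :: q <= minimal}.
  move=> a ap; have: a \in component u by rewrite -Ev -Ep inE.
  exact/subsetP/component_sub/minimal_mutual.
have up : unresolved (v :: q).
  rewrite /unresolved cp /=; apply/and3P; split.
  (* The path has at least two vertices, because [u] and its mutual neighbour [x] both lie on it. *)
  - case: q uq Ep {cp pq mp nl} => // uv Ep.
    move: uv; rewrite inE => /eqP E; subst v.
    have: x \in [set:: [:: u]].
      rewrite Ep; case/orP: Mux => M;
        first by rewrite -(component_mutual u M) componentxx.
      by rewrite (component_mutual u M) componentxx.
    rewrite !inE => /eqP E; subst x.
    by case/orP: Mux => /mutual_irr; rewrite eqxx.
  - apply/negP=> /(minimal_bwd (mp v (mem_head v q)))[y].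
    by rewrite (negPf (nv y)).
  - apply/negP=> /(minimal_fwd (mp _ (mem_last v q)))[y [w [My _ _]]].
    by move: (nl y); rewrite My.
(* Some walk leaves the tail of the picked edge along a mutual arc; by uniqueness of mutual
   successors this is the picked edge, so its tail is inferred after all. *)
have sab : val (pick (v :: q)) \in steps v q := pickP up.
have eF : pick (v :: q) \in F by apply/FP; right; exists (v :: q).
move: (pick _) sab eF => e sab eF.
have Mab := steps_rel pq sab.
have /andP[ap _] := mem_steps sab.
have ma := mp _ ap.
have fa : fwd_inferable (val e).1 by have /andP[] := mutual_fwd_edge Mab.
have [b [w [Mab' wt sw]]] := minimal_fwd ma fa.
have Eb := mutual_edge_inj (postdominates_order G) Mab' Mab.
have se : val e \in steps (entry G) w by rewrite Eb -surjective_pairing in sw.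
have /andP[ia _] := covered_edge_inferred eF wt se.
by move: ma; rewrite inE ia andbF.
Qed.

End Minimal.

Lemma inferred_coverage_valid : inferred_coverage c = vertex_coverage tr.
Proof.
apply/ffunP=> u; apply/idP/idP; first exact: inferred_covered.
move=> cu; apply: contraT => iu.
pose R := [pred v | covered v && ~~ inferred v].
have Ru : R u by rewrite /R /= [covered u]cu iu.
case: (arg_minnP reached Ru) => v /andP[cv iv] vmin.
have nP x : covered x -> ~~ inferred x -> reached v <= reached x.
  by move=> cx ix; apply: vmin; rewrite /R /= cx ix.
by have := minimal_empty nP v; rewrite inE cv iv eqxx.
Qed.

End Validity.

(** * The lower bound *)

Section Distinguishing.

Variable G : cfg.
Implicit Types (u v x y : G) (p q w : seq G) (tr : seq (seq G)).
Implicit Types D : seq (G * G).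

Lemma valid_distinguishes (S : scheme G) tr1 tr2 u :
  valid S -> execution_trace tr1 -> execution_trace tr2 ->
  vertex_coverage tr1 u != vertex_coverage tr2 u ->
  exists2 e, e \in instrumented S & edge_coverage tr1 e != edge_coverage tr2 e.
Proof.
move=> vS t1 t2; rewrite -(vS _ t1) -(vS _ t2) => d12.
apply/exists_inP; apply: contraNT d12 => /exists_inPn same.
suff -> : restrict (instrumented S) (edge_coverage tr1)
          = restrict (instrumented S) (edge_coverage tr2) by [].
by apply/ffunP=> e; rewrite [LHS]ffunE [RHS]ffunE; apply/eqP/negbNE/same/valP.
Qed.

(* A walk from the entry to [v] that uses, besides the arcs in [D], only arcs
   covered by some trace that avoids [v]: such arcs do not reveal whether [v] is
   covered. *)
Definition approachable v D :=
  exists p tr, [/\ path (@arc G) (entry G) p, last (entry G) p = v,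
    execution_trace tr, ~~ vertex_coverage tr v
  & forall a, a \in steps (entry G) p ->
      a \in D \/ exists2 w, w \in tr & a \in steps (entry G) w].

Definition leavable v D :=
  exists p tr, [/\ path (@arc G) v p, last v p = exit G,
    execution_trace tr, ~~ vertex_coverage tr v
  & forall a, a \in steps v p ->
      a \in D \/ exists2 w, w \in tr & a \in steps (entry G) w].

Lemma approachable_entry : approachable (entry G) [::].
Proof. by exists [::], [::]; split=> //; rewrite ffunE. Qed.

Lemma leavable_exit : leavable (exit G) [::].
Proof. by exists [::], [::]; split=> //; rewrite ffunE. Qed.

Lemma detour u v :
  v \in from_entry u -> v \in to_exit u ->
  exists p q, [/\ path (@arc G) (entry G) p, last (entry G) p = v,
    path (@arc G) v q, last v q = exit G
  & execution_trace [:: p ++ q] && ~~ vertex_coverage [:: p ++ q] u].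
Proof.
case/from_entryP=> p [pp lp up] /to_exitP[q [pq lq uq]]; exists p, q;
  split=> //.
rewrite /= /is_walk cat_path last_cat pp lp pq lq eqxx ffunE /= orbF.
move: up uq; rewrite -cat_cons mem_cat negb_or => ->.
by rewrite inE negb_or => /andP[].
Qed.

(** The way to [v] is part of a full walk that avoids [u]; only the final arc into [u] is new. *)
Lemma approachable_free_in u v : v \in free_in u -> approachable u [:: (v, u)].
Proof.
rewrite in_free_in => /and3P[evu Av Bv].
have [p [q [pp lp pq lq /andP[tr nc]]]] := detour Av Bv.
exists (rcons p u), [:: p ++ q]; split=> //; rewrite ?last_rcons //.
  by rewrite rcons_path pp lp.
move=> a; rewrite -cats1 steps_cat lp mem_cat => /orP[sa|]; last by left.
by right; exists (p ++ q); rewrite ?mem_head // steps_cat mem_cat sa.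
Qed.

Lemma leavable_free_out u v : v \in free_out u -> leavable u [:: (u, v)].
Proof.
rewrite in_free_out => /and3P[euv Av Bv].
have [p [q [pp lp pq lq /andP[tr nc]]]] := detour Av Bv.
exists (v :: q), [:: p ++ q]; split=> //; rewrite /= ?euv //.
move=> a; rewrite steps_cons inE => /predU1P[->|sa]; first by left;
  rewrite mem_head.
by right; exists (p ++ q); rewrite ?mem_head // steps_cat lp mem_cat sa orbT.
Qed.

Lemma mutual_path_postdominates v q :
  path (@mutual G) v q -> postdominates (last v q) v.
Proof.
have [Pt _ _] := postdominates_order G.
elim: q v => [|w q IHq] v /=; first by rewrite postdominatesxx.
by case/andP=> /and4P[_ _ Pwv _] /IHq Plw; apply: Pt Pwv.
Qed.

Lemma instrumented_on_path (S : scheme G) v q D D' :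
  valid S -> path (@mutual G) v q -> approachable v D ->
  leavable (last v q) D' ->
  exists2 e, e \in instrumented S & val e \in D ++ steps v q ++ D'.
Proof.
move=> vS pq [p [tr [pp lp trP nv Dp]]] [r [tr' [pr lr trP' nl Dr]]].
pose w := p ++ q ++ r.
have paq : path (@arc G) v q by apply: sub_path pq => a b /and4P[].
have ww : is_walk w by rewrite /is_walk !cat_path !last_cat lp pp paq pr lr /=.
have T1 : execution_trace (tr ++ tr') by rewrite /execution_trace all_cat;
  apply/andP.
have T2 : execution_trace (w :: tr ++ tr') by rewrite /= ww.
(* Walks of [tr'] only avoid [last v q] by assumption, but that vertex postdominates [v], so they
   miss [v] too. *)
have nc : ~~ vertex_coverage (tr ++ tr') v.
  apply/negP=> /vertex_coverageP[w']; rewrite mem_cat => /orP[wt|wt] vw.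
    by case/negP: nv; apply/vertex_coverageP; exists w'.
  case/negP: nl; apply/vertex_coverageP; exists w' => //.
  apply: walk_postdominates vw (mutual_path_postdominates pq).
  exact: allP trP' _ wt.
have cw : vertex_coverage (w :: tr ++ tr') v.
  apply/vertex_coverageP; exists w; rewrite ?mem_head // -cat_cons mem_cat.
  by rewrite -lp mem_last.
have [|e eF] := valid_distinguishes vS T2 T1 (u := v);
  first by rewrite cw (negPf nc).
rewrite !ffunE /=; set b := has _ _ => ne.
(* Adding [w] can only turn values on, so a differing edge lies on [w] and on no walk of
   [tr ++ tr']. *)
have [sw nb] : val e \in steps (entry G) w /\ ~~ b.
  by move: ne; rewrite /steps; case: (b) (val e \in zip _ _) => [] [].
have nt w' : w' \in tr ++ tr' -> val e \notin steps (entry G) w'.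
  by move=> wt; apply: contra nb => sw'; apply/hasP; exists w'.
exists e => //; move: sw; rewrite /w !steps_cat lp !mem_cat =>
  /or3P[/Dp|->|/Dr].
- by case=> [->//|[w' wt]]; rewrite (negPf (nt w' _)) // mem_cat wt.
- by rewrite orbT.
- by case=> [->|[w' wt]]; rewrite ?orbT // (negPf (nt w' _)) // mem_cat wt orbT.
Qed.

End Distinguishing.

Lemma card_sum_bool (T : finType) (A : {set T}) (P : pred T) :
  #|[set e in A | P e]| = \sum_(e in A) P e.
Proof.
rewrite -sum1_card big_mkcond [RHS]big_mkcond; apply: eq_bigr => e _.
by rewrite inE; case: (e \in A); case: (P e).
Qed.

Section LowerBound.

Variable G : cfg.
Implicit Types (u v x y : G) (p q : seq G) (B : {set G}) (F : {set edge G}).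

Lemma edge_inj (e e' : edge G) :
  (val e).1 = (val e').1 -> (val e).2 = (val e').2 -> e = e'.
Proof.
move=> E1 E2; apply: val_inj.
by rewrite [LHS]surjective_pairing [RHS]surjective_pairing E1 E2.
Qed.

Lemma card_in_edges_from u : #|in_edges_from (free_in u) u| = #|free_in u|.
Proof.
rewrite -(@card_in_imset _ _ (fun e : edge G => (val e).1)); last first.
  move=> e e'; rewrite !inE => /andP[_ /eqP E1] /andP[_ /eqP E2] E.
  by apply: edge_inj; rewrite // E1 E2.
apply: eq_card => x; apply/imsetP/idP => [[e]|ux].
  by rewrite inE => /andP[ue _] ->.
have xu : arc x u by move: ux; rewrite in_free_in => /andP[].
by exists (Sub (x, u) xu : edge G); rewrite ?SubK // in_set SubK /= ux eqxx.
Qed.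

Lemma card_out_edges_to u : #|out_edges_to u (free_out u)| = #|free_out u|.
Proof.
rewrite -(@card_in_imset _ _ (fun e : edge G => (val e).2)); last first.
  move=> e e'; rewrite !inE => /andP[/eqP E1 _] /andP[/eqP E2 _] E.
  by apply: edge_inj; rewrite // E1 E2.
apply: eq_card => x; apply/imsetP/idP => [[e]|ux].
  by rewrite inE => /andP[_ ue] ->.
have xu : arc u x by move: ux; rewrite in_free_out => /andP[].
by exists (Sub (u, x) xu : edge G); rewrite ?SubK // in_set SubK /= ux eqxx.
Qed.

Lemma unresolved_uniq p : unresolved p -> uniq p && (1 < size p).
Proof. by case: p => // v q /and4P[/and3P[-> _ _] -> _ _]. Qed.

(** Duplicate-free sequences have bounded length, so unresolved paths range over a finite type and
    can be quantified over in a set comprehension. *)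
Lemma unresolved_bseq p : unresolved p -> exists p' : #|G|.-bseq G, val p' = p.
Proof.
move/unresolved_uniq=> /andP[Up _].
have sp : size p <= #|G| by rewrite -(card_uniqP Up) max_card.
by exists (Bseq sp).
Qed.

Definition incident F B : {set edge G} :=
  [set e in F | ((val e).1 \in B) || ((val e).2 \in B)].

Variable S : scheme G.
Hypothesis vS : valid S.

(** If an edge from [free_in u] and an edge to [free_out u] were both missing,
    [instrumented_on_path] for the one-vertex path at [u] would still make one of the two
    instrumented. *)
Lemma ambiguous_instrumented u :
  (in_edges_from (free_in u) u \subset instrumented S)
  || (out_edges_to u (free_out u) \subset instrumented S).
Proof.
rewrite -implyNb; apply/implyP=> /subsetPn[e];
  rewrite in_set => /andP[e1 /eqP e2] eS.
apply/subsetP=> e'; rewrite in_set => /andP[/eqP e'1 e'2].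
have [|e'' e''S] := @instrumented_on_path _ S u [::] _ _ vS _
  (approachable_free_in e1) (leavable_free_out e'2); first by [].
rewrite cat1s mem_seq2 => /orP[] /eqP E.
  have Ee : e = e'' by apply: edge_inj; rewrite E.
  by rewrite Ee e''S in eS.
have -> : e' = e'' by apply: edge_inj; rewrite E.
exact: e''S.
Qed.

Lemma ambiguous_incident u m :
  m <= #|free_in u| -> m <= #|free_out u| ->
  m <= #|incident (instrumented S) [set u]|.
Proof.
rewrite -card_in_edges_from -card_out_edges_to => m1 m2.
case/orP: (ambiguous_instrumented u) => /subsetP sS.
  apply: leq_trans m1 (subset_leq_card _); apply/subsetP=> e eI.
  by rewrite !inE sS //; move: eI; rewrite inE => /andP[_ ->]; rewrite orbT.
apply: leq_trans m2 (subset_leq_card _); apply/subsetP=> e eI.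
by rewrite !inE sS //; move: eI; rewrite inE => /andP[->].
Qed.

(** Not being backward inferable, the first vertex is the entry or has a free in-neighbour; dually
    for the last one. The added arcs end or start on the path, so they are incident with it. *)
Lemma unresolved_incident p :
  unresolved p -> 0 < #|incident (instrumented S) [set:: p]|.
Proof.
case: p => // v q /and4P[cp _ nb nf].
have [D [aD DP]] :
    exists D, approachable v D /\ forall a, a \in D -> a.2 \in v :: q.
  have [->|vs] := eqVneq v (entry G); first by exists [::]; split=> //;
    apply: approachable_entry.
  have /set0Pn[x xv] : free_in v != set0.
    by move: nb; rewrite bwd_inferableP vs.
  exists [:: (x, v)]; split; first exact: approachable_free_in.
  by move=> a; rewrite !inE => /eqP->; rewrite eqxx.
have [D' [aD' DP']] :
    exists D, leavable (last v q) D /\ forall a, a \in D -> a.1 \in v :: q.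
  have [->|vt] := eqVneq (last v q) (exit G).
    by exists [::]; split=> //; apply: leavable_exit.
  have /set0Pn[x xv] : free_out (last v q) != set0.
    by move: nf; rewrite fwd_inferableP vt.
  exists [:: (last v q, x)]; split; first exact: leavable_free_out.
  by move=> a; rewrite inE => /eqP->; apply: mem_last.
have [e eS] := instrumented_on_path vS (component_path_mutual cp) aD aD'.
move=> He; apply/card_gt0P; exists e; rewrite !in_set eS /=.
move: He; rewrite !mem_cat => /or3P[/DP->|/mem_steps/andP[-> _]|/DP'->] //.
by rewrite orbT.
Qed.

Variables (F : {set edge G}) (use_in : G -> bool) (pick : seq G -> edge G).
Hypothesis useP : forall u, ambiguous u ->
  if use_in u then #|free_in u| <= #|free_out u|
  else #|free_out u| <= #|free_in u|.
Hypothesis FP : forall e : edge G, (e \in F) <->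
          (exists2 u, ambiguous u &
             e \in if use_in u then in_edges_from (free_in u) u
                   else out_edges_to u (free_out u)) \/
          (exists2 p, unresolved p & e = pick p).

Let chosen u := if use_in u then in_edges_from (free_in u) u
                else out_edges_to u (free_out u).

(* The part of [F] that the algorithm instruments on behalf of the block [B]. *)
Let charged B : {set edge G} :=
  [set e in F | [exists u in B, ambiguous u && (e \in chosen u)]
     || [exists p : #|G|.-bseq G,
          [&& unresolved p, [set:: p] == B & e == pick p]]].

Lemma chosen_incident u :
  ambiguous u -> #|chosen u| <= #|incident (instrumented S) [set u]|.
Proof.
move=> /useP; rewrite /chosen; case: (use_in u) => le;
  apply: ambiguous_incident.
- by rewrite card_in_edges_from.
- by rewrite card_in_edges_from.
- by rewrite card_out_edges_to.
- by rewrite card_out_edges_to.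
Qed.

Lemma charged_incident u :
  #|charged (component u)| <= #|incident (instrumented S) (component u)|.
Proof.
(* A component with an ambiguous vertex is a singleton, too small for an unresolved path, so only
   [chosen] edges are charged to it. Any other component is charged at most one picked edge. *)
case: (pickP [pred a in component u | ambiguous a]) => [a /andP[ua aa]|na].
  rewrite -(component_eq ua) (ambiguous_component aa).
  apply: leq_trans (chosen_incident aa); apply/subset_leq_card/subsetP=> e.
  rewrite inE => /andP[_ /orP[/exists_inP[b]|/existsP[p /and3P[up /eqP Ep _]]]].
    by rewrite inE => /eqP-> /andP[].
  have /andP[Up sp] := unresolved_uniq up.
  have : #|[set:: p]| <= 1 by rewrite Ep cards1.
  by rewrite cardsE (card_uniqP Up) leqNgt sp.
have [->|/set0Pn[e0]] := eqVneq (charged (component u)) set0;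
  first by rewrite cards0.
have unr e : e \in charged (component u) -> exists p,
    [/\ unresolved p, [set:: p] = component u & e = pick p].
  rewrite inE => /andP[_ /orP[/exists_inP[b ub /andP[ab _]]|/existsP[p]]].
    by have := na b; rewrite inE /= ub ab.
  by case/and3P=> up /eqP Ep /eqP->; exists p.
case/unr=> p [up Ep _]; rewrite -Ep.
apply: leq_trans (unresolved_incident up); rewrite -(cards1 (pick p)).
apply/subset_leq_card/subsetP=> e; rewrite Ep => /unr[p' [up' Ep' ->]].
rewrite inE; apply/eqP; congr pick.
case: p p' up up' Ep Ep' =>
  [|v q] // [|v' q'] // /and4P[cp _ _ _] /and4P[cp' _ _ _] Ep Ep'.
apply: component_path_eq => // x.
by move/setP/(_ x): Ep'; rewrite -Ep !in_set.
Qed.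

Lemma local_instrumentation_le : #|F| <= 2 * #|instrumented S|.
Proof.
pose P := [set component u | u : G].
have cP u : component u \in P by apply: imset_f.
have PP B a : B \in P -> a \in B -> B = component a.
  by case/imsetP=> u _ -> au; rewrite (component_eq au).
have -> : #|F| = \sum_(e in F) 1 by rewrite sum1_card.
(* Each edge of [F] is charged to at least one component; the double sum is then exchanged. *)
apply: (@leq_trans (\sum_(e in F) \sum_(B in P) (e \in charged B))).
  apply: leq_sum => e eF.
  have [B BP eB] : exists2 B, B \in P & e \in charged B.
    case: (FP e) => /(_ eF) [[u au eu] _|[p up Ee] _].
      exists (component u) => //; rewrite inE eF /=; apply/orP; left.
      by apply/exists_inP; exists u; rewrite ?componentxx // au.
    have [p' Ep'] := unresolved_bseq up.
    case: p up Ee Ep' => // v q up Ee Ep'; exists (component v) => //.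
    rewrite inE eF; apply/orP; right; apply/existsP; exists p'.
    by rewrite Ep' up Ee eqxx andbT; case/and4P: up => /and3P[].
  by rewrite (bigD1 B) //= eB.
rewrite exchange_big /=.
apply: (@leq_trans (\sum_(B in P) \sum_(e in instrumented S)
                      (((val e).1 \in B) || ((val e).2 \in B)))).
  apply: leq_sum => B /imsetP[u _ ->].
  rewrite -card_sum_bool -card_sum_bool.
  apply: leq_trans (charged_incident u); apply: subset_leq_card.
  by apply/subsetP=> e; rewrite inE => /andP[].
(* The factor 2 counts the endpoints of an edge, each of which lies in exactly one component. *)
rewrite exchange_big /= mulnC -sum_nat_const; apply: leq_sum => e _.
have one a : \sum_(B in P) (a \in B) = 1.
  rewrite (bigD1 (component a)) //= componentxx big1 // => B /andP[BP nB].
  by apply/eqP; rewrite eqb0; apply: contra nB => aB; rewrite (PP B a).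
rewrite -[2]/(1 + 1) -{1}(one (val e).1) -(one (val e).2) -big_split /=.
by apply: leq_sum => B _; case: (_ \in B); case: (_ \in B).
Qed.

End LowerBound.

(** * Circuits *)

Section Circuits.

Variable I : finType.
Implicit Types (c d : seq (gate I)) (f : {ffun I -> bool} -> bool).

Lemma eval_circuit_rcons c g (x : I -> bool) :
  eval_circuit (rcons c g) x =
  rcons (eval_circuit c x) (eval_gate x (eval_circuit c x) g).
Proof. by rewrite /eval_circuit foldl_rcons. Qed.

Lemma size_eval_circuit c (x : I -> bool) : size (eval_circuit c x) = size c.
Proof.
elim/last_ind: c => // c g IHc.
by rewrite eval_circuit_rcons !size_rcons IHc.
Qed.

Lemma nth_eval_circuit_cat c d (x : I -> bool) j :
  j < size c -> nth false (eval_circuit (c ++ d) x) j =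
    nth false (eval_circuit c x) j.
Proof.
move=> jc; elim/last_ind: d => [|d g IHd]; first by rewrite cats0.
rewrite -rcons_cat eval_circuit_rcons nth_rcons size_eval_circuit size_cat.
by rewrite ltn_addr.
Qed.

(** The bound on [j] keeps the output unchanged when gates are appended; a position past the end
    would read the default [false]. *)
Definition computes c f : Prop :=
  exists2 j, j < size c &
    forall x : {ffun I -> bool}, nth false (eval_circuit c x) j = f x.

Lemma computes_cat c d f : computes c f -> computes (c ++ d) f.
Proof.
case=> j jc cj; exists j; first by rewrite size_cat ltn_addr.
by move=> x; rewrite nth_eval_circuit_cat.
Qed.

Lemma computes_rcons c g :
  computes (rcons c g) (fun x => eval_gate x (eval_circuit c x) g).
Proof.
exists (size c); first by rewrite size_rcons.
by move=> x; rewrite eval_circuit_rcons nth_rcons size_eval_circuit ltnn eqxx.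
Qed.

Lemma computes_ext c f f' : f =1 f' -> computes c f -> computes c f'.
Proof. by move=> ff' [j jc cj]; exists j => // x; rewrite -ff'. Qed.

(** One [GOr] per element, plus a constant [false] for the empty list. *)
Lemma computes_has (J : eqType) (s : seq J)
    (f : J -> {ffun I -> bool} -> bool) c :
  (forall j, j \in s -> computes c (f j)) ->
  exists d, size d <= (size s).+1
            /\ computes (c ++ d) (fun x => has (fun j => f j x) s).
Proof.
elim: s => [|j s IHs] cf.
  by exists [:: GConst I false]; rewrite cats1; split=> //;
    apply: computes_rcons.
have [|d [sd [b bd cb]]] := IHs; first by move=> j' js; apply: cf;
  rewrite inE js orbT.
have [a ac ca] := computes_cat d (cf j (mem_head j s)).
exists (rcons d (GOr I a b)); rewrite size_rcons; split=> //.
rewrite -rcons_cat; apply: computes_ext (computes_rcons _ _) => x /=.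
by rewrite ca cb.
Qed.

(** The hypothesis quantifies over [d] because the gates for [j] are placed after those already
    built for other elements. *)
Lemma computes_each (J : eqType) (s : seq J)
    (f : J -> {ffun I -> bool} -> bool) c k :
  (forall j d, j \in s ->
     exists d', size d' <= k /\ computes ((c ++ d) ++ d') (f j)) ->
  exists d, size d <= size s * k /\ forall j, j \in s ->
    computes (c ++ d) (f j).
Proof.
elim: s => [|j s IHs] cf; first by exists [::].
have [|d [sd cd]] := IHs; first by move=> j' d js; apply: cf;
  rewrite inE js orbT.
have [d' [sd' cd']] := cf j d (mem_head j s).
exists (d ++ d'); split; first by rewrite size_cat mulSn addnC leq_add.
move=> j'; rewrite inE catA => /predU1P[->//|/cd]; exact: computes_cat.
Qed.

Lemma computes_circuit_complexity (O : finType) m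
    (f : {ffun I -> bool} -> {ffun O -> bool}) c :
  size c <= m -> (forall v, computes c (f^~ v)) -> circuit_complexity_le m f.
Proof.
move=> cm cf.
have /fin_all_exists[out outP] (v : O) : exists j,
    forall x : {ffun I -> bool}, f x v = nth false (eval_circuit c x) j.
  by have [j _ cj] := cf v; exists j => x; rewrite cj.
by exists c, out; split=> // x v.
Qed.

End Circuits.

Section DecodingCircuit.

Variables (G : cfg) (F : {set edge G}).

Let I : finType := {e : edge G | e \in F}.

Let stage n (v : G) (x : restricted_profile F) : bool :=
  v \in iter n (infer_step x) set0.

Lemma stage_circuit n :
  exists c : seq (gate I),
  [/\ size c <= #|I| + #|G| + n * (#|G| * (#|I| + #|G|).+1),
      forall i : I, computes c (fun x => x i)
    & forall v, computes c (stage n v)].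
Proof.
elim: n => [|n [c [sc ci cv]]].
  have [|c [sc ci]] := @computes_each I I (enum I) (fun i x => x i) [::] 1.
    move=> i d _; exists [:: GInput i]; rewrite cats1; split=> //.
    exact: computes_rcons.
  have [|d [sd cd]] := @computes_each I G (enum G) (stage 0) c 1.
    move=> v d _; exists [:: GConst I false]; rewrite cats1; split=> //.
    by apply: computes_ext (computes_rcons _ _) => x; rewrite /stage inE.
  exists (c ++ d); split=> [|i|v]; first 1 last.
  - by apply/computes_cat/ci; rewrite mem_enum.
  - by apply: cd; rewrite mem_enum.
  by move: sc sd; rewrite -!cardE !muln1 size_cat mul0n addn0; apply: leq_add.
(* The values whose disjunction decides [u] at the next stage: inputs of edges at [u], and
   previous-stage values of its inference successors. *)
pose src u : seq (I + G) :=
  [seq inl e | e <- enum I & (u == (val (val e)).1) || (u == (val (val e)).2)]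
  ++ [seq inr v | v <- enum G & infers u v].
pose fn (j : I + G) (x : {ffun I -> bool}) :=
  match j with inl e => x e | inr v => stage n v x end.
have cfn j : computes c (fn j) by case: j.
have [|d [sd cd]] :=
  @computes_each I G (enum G) (stage n.+1) c (#|I| + #|G|).+1.
  move=> u d _.
  have [|d' [sd' cd']] := @computes_has I _ (src u) fn (c ++ d).
    by move=> j _; apply: computes_cat.
  exists d'; split.
    apply: leq_trans sd' _; rewrite ltnS size_cat !size_map !size_filter !cardE.
    by rewrite leq_add // count_size.
  apply: computes_ext cd' => x; rewrite /stage iterS inE has_cat !has_map.
  congr (_ || _); apply/hasP/existsP.
  - case=> e; rewrite mem_filter => /andP[ue _] xe; exists e; exact/andP.
  - by case=> e /andP[xe ue]; exists e; rewrite // mem_filter ue mem_enum.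
  - case=> v; rewrite mem_filter => /andP[uv _] xv; exists v; exact/andP.
  - by case=> v /andP[xv uv]; exists v; rewrite // mem_filter uv mem_enum.
exists (c ++ d); split=> [|i|v].
- by rewrite size_cat mulSn addnCA addnC leq_add // [X in X * _]cardE.
- exact: computes_cat.
- by apply: cd; rewrite mem_enum.
Qed.

Lemma card_cfg : 1 < #|G|.
Proof.
by apply/card_gt1P; exists (entry G), (exit G); rewrite entry_neq_exit.
Qed.

Lemma inferred_coverage_complexity :
  circuit_complexity_le (#|G| ^ 6) (@inferred_coverage G F).
Proof.
have [c [sc _ cv]] := stage_circuit #|G|.
apply: (computes_circuit_complexity (c := c)); last first.
  by move=> v; apply: computes_ext (cv v) => x; rewrite ffunE.
apply: leq_trans sc _.
have cI : #|I| <= #|G| * #|G|.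
  rewrite card_sig -card_prod; apply: leq_trans (max_card _) _.
  by rewrite card_sig max_card.
have n2 := card_cfg; move: #|G| #|I| cI n2 => n i le_i n2.
have le4 : 4 <= n ^ 2 by rewrite (leq_sqr 2).
have n4 : 4 * n ^ 4 <= n ^ 6 by rewrite [n ^ 6](expnD n 2 4) leq_mul2r le4 orbT.
have n3 : n ^ 3 <= n ^ 4 by rewrite leq_exp2l.
have n22 : 2 * n ^ 2 <= n ^ 4.
  by rewrite [n ^ 4](expnD n 2 2) leq_mul2r (leq_trans _ le4) ?orbT.
have n1 : n <= n ^ 4 by rewrite -[X in X <= _]expn1 leq_exp2l.
(* The size is at most [n ^ 4 + n ^ 3 + 2 * n ^ 2 + n], where each summand is at most [n ^ 4], and
   [4 <= n ^ 2] since there are at least two nodes. *)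
apply: leq_trans n4; apply: (@leq_trans (n ^ 4 + n ^ 3 + 2 * n ^ 2 + n)).
  apply: (@leq_trans (n * n + n + n * (n * (n * n + n).+1))).
    by rewrite leq_add ?leq_add2r // !leq_mul2l ltnS leq_add2r le_i !orbT.
  rewrite mulnS !mulnDr !mulnn -!expnS addnAC addnA addnn -mul2n.
  by rewrite [2 * _ + _]addnC.
rewrite -[4]/(1 + 1 + 1 + 1) !mulnDl !mul1n.
by rewrite !leq_add.
Qed.

End DecodingCircuit.

(** * Existence of a local instrumentation *)

Section Existence.

Variable G : cfg.

Lemma first_edge : exists pick : seq G -> edge G,
  forall p, unresolved p -> val (pick p) \in zip p (behead p).
Proof.
have [v] := exists_out_to_exit (entry_neq_exit G); rewrite inE => ev _.
(* Pick the first arc of the path; an arc out of the entry serves as default where [p] has no such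
   arc. *)
exists (fun p => if p is a :: b :: _ then insubd (Sub (entry G, v) ev) (a, b)
                 else Sub (entry G, v) ev).
case=> [|a [|b q]] //; first by case/and4P.
case/and4P=> /component_path_mutual /andP[/and4P[eab _ _ _] _] _ _ _.
by rewrite val_insubd /= eab mem_head.
Qed.

Lemma local_instrumentation_exists :
  exists S : scheme G, local_instrumentation S.
Proof.
have [pick pickP] := first_edge.
pose use_in (u : G) := #|free_in u| <= #|free_out u|.
pose F : {set edge G} := [set e |
  [exists u, ambiguous u && (e \in if use_in u then in_edges_from (free_in u) u
                                   else out_edges_to u (free_out u))]
  || [exists p : #|G|.-bseq G, unresolved p && (e == pick p)]].
exists (Scheme (@inferred_coverage G F)), F => //; exists use_in, pick;
  split=> //.
  by move=> u _; rewrite /use_in; case: leqP => // /ltnW.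
move=> e; rewrite inE; split.
  case/orP=> /existsP[]; last by move=> p /andP[up /eqP ep]; right; exists p.
  by move=> u /andP[au eu]; left; exists u.
case=> [[u au eu]|[p up ->]]; apply/orP; [left | right].
  by apply/existsP; exists u; rewrite au.
have [p' Ep] := unresolved_bseq up; apply/existsP; exists p'.
by rewrite Ep up eqxx.
Qed.

End Existence.

Theorem theorem4 :
  exists k : nat, forall G : cfg,
    (exists S : scheme G, local_instrumentation S) /\
    (forall S : scheme G, local_instrumentation S ->
       [/\ circuit_complexity_le (#|G| ^ k) (@decode G S),
           valid S
         & forall S' : scheme G, valid S' ->
             scheme_size S <= 2 * scheme_size S']).
Proof.
exists 6 => G; split; first exact: local_instrumentation_exists.
move=> _ [F [use_in [pick [useP pickP FP]]] ->]; split.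
- exact: inferred_coverage_complexity.
- by move=> tr trP; exact: (inferred_coverage_valid pickP FP trP).
- by move=> S' vS'; exact: (local_instrumentation_le vS' useP FP).
Qed.
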